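(* Let $(M,d)$ be a countable proper pointed metric space. Then the Lipschitz-free space $\mathcal{F}(M)$ has the metric approximation property.
   Context: All spaces are real. A metric space is proper if every closed ball is compact. A pointed metric space $(M,d)$ is a metric space with a distinguished point (origin) $0\in M$. $Lip_0(M)$ is the Banach space of Lipschitz functions $f:M\to\mathbb{R}$ with $f(0)=0$, normed by the Lipschitz constant. For $x\in M$, $\delta_x\in Lip_0(M)^*$ is given by $\delta_x(f)=f(x)$; the Lipschitz-free space $\mathcal{F}(M)$ is the norm-closed linear span of $\{\delta_x: x\in M\}$ in $Lip_0(M)^*$. A Banach space $X$ has the metric approximation property if for every $\varepsilon>0$ and every compact $K\subset X$ there is a finite-rank bounded linear operator $T:X\to X$ with $\|T\|\le 1$ and $\|Tx-x\|<\varepsilon$ for every $x\in K$. *)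

(* Defs.v *)
From HB Require Import structures.
From mathcomp Require Import all_boot all_order all_algebra.
From mathcomp Require Import all_classical reals interval_inference.
From mathcomp Require Import topology normedtype.

Set Implicit Arguments.
Unset Strict Implicit.
Unset Printing Implicit Defensive.

Import Order.TTheory GRing.Theory Num.Theory.
Import numFieldNormedType.Exports.

Local Open Scope classical_set_scope.
Local Open Scope ring_scope.

(* [closed_ball] of the library is the closure of an open ball, which may be
   smaller than the set of points at distance at most r used here. *)
Definition proper_metric (R : realType) (M : metricType R) :=
  forall (x : M) (r : R), compact [set y | mdist x y <= r].

Section operators.
Context {R : realType}.
Implicit Types V W : normedModType R.

Definition lspan {V} (A : set V) : set V :=
  [set v | exists2 s : seq (R * V),
     (forall p, p \in s -> A p.2) & v = \sum_(p <- s) p.1 *: p.2].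

Definition bounded_operator {V W} (f : V -> W) :=
  exists C : R, forall v, `|f v| <= C * `|v|.

(* Only meaningful for bounded operators: [sup] is 0 on unbounded sets. *)
Definition opnorm {V W} (f : V -> W) : R :=
  sup [set `|f v| | v in [set v : V | `|v| <= 1]].

Definition finite_rank {V W} (f : V -> W) :=
  exists s : seq W, range f = lspan [set` s].

Lemma opnorm_has_sup {V W} (f : V -> W) : bounded_operator f ->
  has_sup [set `|f v| | v in [set v : V | `|v| <= 1]].
Proof.
move=> [C fC]; split; first by exists `|f 0|, 0; rewrite //= normr0.
exists `|C| => _ [v /= v1 <-]; apply: le_trans (fC v) _.
apply: le_trans (_ : `|C| * `|v| <= _).
  by rewrite ler_wpM2r// ler_norm.
by rewrite ler_piMr.
Qed.

Lemma opnorm_ge0 {V W} (f : V -> W) : bounded_operator f -> 0 <= opnorm f.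
Proof.
move=> bf; apply: le_trans (normr_ge0 (f 0)) _.
have /sup_upper_bound := opnorm_has_sup bf; apply.
by exists 0; rewrite //= normr0.
Qed.

Lemma opnormP {V W} (f : V -> W) (v : V) : bounded_operator f ->
  (forall (a : R) u, f (a *: u) = a *: f u) -> `|f v| <= opnorm f * `|v|.
Proof.
move=> bf fZ; have [->|v0] := eqVneq v 0.
  by rewrite -(scale0r (0 : V)) fZ scale0r scale0r !normr0 mulr0.
have nv0 : 0 < `|v| by rewrite normr_gt0.
rewrite -ler_pdivrMr//.
have -> : `|f v| / `|v| = `|f (`|v|^-1 *: v)|.
  by rewrite fZ normrZ normfV normr_id mulrC.
have /sup_upper_bound := opnorm_has_sup bf; apply.
by exists (`|v|^-1 *: v) => //=; rewrite normrZ normfV normr_id mulVf// gt_eqF.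
Qed.

Lemma opnorm_le {V W} (f : V -> W) (C : R) : 0 <= C ->
  (forall v, `|f v| <= C * `|v|) -> opnorm f <= C.
Proof.
move=> C0 fC; apply: ge_sup; first by exists `|f 0|, 0; rewrite //= normr0.
move=> _ [v /= v1 <-]; apply: le_trans (fC v) _.
by rewrite ler_piMr.
Qed.

End operators.

Definition metric_approximation_property (R : realType)
    (X : completeNormedModType R) :=
  forall (eps : R) (K : set X), 0 < eps -> compact K ->
  exists T : {linear X -> X},
    [/\ bounded_operator T, finite_rank T, opnorm T <= 1 &
        forall x, K x -> `|T x - x| < eps].

Section dual.
Context {R : realType} (V : normedModType R).

Definition dual_pred : {pred V -> R} :=
  mem [set f : V -> R | scalar f /\ bounded_operator f].

Record dual := Dual { dual_fun :> V -> R; dual_funP : dual_fun \in dual_pred }.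

HB.instance Definition _ := [isSub for dual_fun].
HB.instance Definition _ := [Choice of dual by <:].

Lemma dual_scalar (f : dual) : scalar f.
Proof. by have := dual_funP f; rewrite inE => -[]. Qed.

Lemma dual_bounded (f : dual) : bounded_operator f.
Proof. by have := dual_funP f; rewrite inE => -[]. Qed.

HB.instance Definition _ (f : dual) :=
  GRing.isLinear.Build R V R *%R (f : V -> R) (dual_scalar f).

Lemma dual_submod_closed : submod_closed dual_pred.
Proof.
split.
  rewrite inE/=; split; first by move=> a u v; rewrite /GRing.scale/= mulr0 addr0.
  by exists 0 => v; rewrite normr0 mul0r.
move=> a f g; rewrite !inE/= => -[lf [C fC]] [lg [D gD]]; split.
  move=> b u v; rewrite /= !fctE lf lg /GRing.scale/=.
  by rewrite !mulrDr mulrCA addrACA.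
exists (`|a| * C + D) => v; rewrite !fctE (le_trans (ler_normD _ _))// mulrDl.
by rewrite lerD// normrM -mulrA ler_wpM2l.
Qed.

HB.instance Definition _ := GRing.isSubmodClosed.Build _ _ dual_pred
  dual_submod_closed.
HB.instance Definition _ := [SubChoice_isSubLmodule of dual by <:].

Let dnorm (f : dual) : R := opnorm f.

Let dualZ (f : dual) (a : R) u : f (a *: u) = a *: f u.
Proof. exact: linearZ. Qed.

Let dnormP (f : dual) v : `|f v| <= dnorm f * `|v|.
Proof. exact: opnormP (dual_bounded f) (dualZ f). Qed.

Let dnorm_ge0 f : 0 <= dnorm f.
Proof. exact: opnorm_ge0 (dual_bounded f). Qed.

Let ler_dnormD f g : dnorm (f + g) <= dnorm f + dnorm g.
Proof.
apply: opnorm_le => [|v]; first exact: addr_ge0.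
by rewrite (le_trans (ler_normD _ _))// mulrDl lerD.
Qed.

Let dnormZ (a : R) f : dnorm (a *: f) = `|a| * dnorm f.
Proof.
have le b g : dnorm (b *: g) <= `|b| * dnorm g.
  apply: opnorm_le => [|v]; first exact: mulr_ge0.
  by rewrite normrM -mulrA ler_wpM2l.
apply/eqP; rewrite eq_le le/=.
have [->|a0] := eqVneq a 0; first by rewrite normr0 mul0r.
rewrite -ler_pdivlMl ?normr_gt0// -normfV.
by have := le a^-1 (a *: f); rewrite scalerA mulVf// scale1r.
Qed.

Let dnorm_eq0 f : dnorm f = 0 -> f = 0.
Proof.
move=> f0; apply/val_inj/funext => v; apply/eqP.
by rewrite -normr_le0; have := dnormP f v; rewrite f0 mul0r.
Qed.

HB.instance Definition _ :=
  Lmodule_isNormed.Build R dual ler_dnormD dnormZ dnorm_eq0.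

Lemma dual_normE (f : dual) : `|f| = opnorm f. Proof. by []. Qed.

Lemma dual_normP (f : dual) v : `|f v| <= `|f| * `|v|. Proof. exact: dnormP. Qed.

Lemma dual_complete (F : set_system dual) : ProperFilter F -> cauchy F -> cvg F.
Proof.
move=> FF /cauchy_ballP Fc.
have Fn e : 0 < e -> \forall f & g \near F, `|f - g| < e.
  by move=> e0; apply: filterS (Fc _ e0) => -[f g]; rewrite -ball_normE.
have Fev v : cvg ((fun f : dual => f v) @ F).
  apply/cauchy_cvgP/cauchy_ballP => e e0.
  have d0 : 0 < e / (`|v| + 1) by rewrite divr_gt0// ltr_wpDl.
  have [[A B]/= [FA FB] AB] := Fn _ d0.
  exists (dual_fun ^~ v @` A, dual_fun ^~ v @` B).
    by split; [apply: filterS FA|apply: filterS FB] => f ?; exists f.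
  move=> [_ _]/= [[f Af <-] [h Bh <-]]; rewrite -ball_normE/=.
  rewrite (le_lt_trans (dual_normP (f - h) v))//.
  rewrite (@le_lt_trans _ _ (`|f - h| * (`|v| + 1)))//.
    by rewrite ler_wpM2l// lerDl.
  by rewrite -ltr_pdivlMr ?ltr_wpDl//; exact: (AB (f, h)).
pose g v : R := lim ((fun f : dual => f v) @ F).
have gE v : (fun f : dual => f v) @ F --> g v by exact: Fev.
have Fg e : 0 < e -> \forall f \near F, forall v, `|(f : dual) v - g v| <= e * `|v|.
  move=> e0; have [[A B]/= [FA FB] AB] := Fn _ e0.
  apply: filterS FA => f Af v.
  have fg : (fun h : dual => `|f v - h v|) @ F --> `|f v - g v|.
    by apply: cvg_norm; apply: cvgB => //; exact: cvg_cst.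
  rewrite -(cvg_lim _ fg)//; apply: limr_le; first by apply/cvg_ex; eexists; exact: fg.
  apply: filterS FB => h Bh.
  rewrite (le_trans (dual_normP (f - h) v))// ler_wpM2r// ltW//.
  exact: (AB (f, h)).
have gs : scalar g.
  move=> a u v; apply: cvg_lim => //=.
  rewrite (_ : (fun f : dual => f (a *: u + v)) = (fun f => a *: f u + f v)).
    by apply: cvgD => //; apply: cvgZr.
  by apply/funext => f; rewrite linearP.
have gb : bounded_operator g.
  have [f fg] := filter_ex (Fg _ ltr01); exists (`|f| + 1) => v.
  rewrite -[g v](subKr (f v)) (le_trans (ler_normB _ _))// mulrDl.
  by rewrite lerD// dual_normP.
have gP : g \in dual_pred by rewrite inE.
apply/cvg_ex; exists (Dual gP); apply/cvgrPdistC_le => e e0.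
apply: filterS (Fg _ e0) => f fg; apply: opnorm_le; [exact: ltW|exact: fg].
Qed.

HB.instance Definition _ := Uniform_isComplete.Build dual dual_complete.

End dual.

Section closed_span.
Context {R : realType} {V : normedModType R} (A : set V).

Definition closed_span_pred : {pred V} := mem (closure (lspan A)).

Record closed_span :=
  ClosedSpan { cspan_val : V; cspan_valP : cspan_val \in closed_span_pred }.

HB.instance Definition _ := [isSub for cspan_val].
HB.instance Definition _ := [Choice of closed_span by <:].

Lemma closed_span_submod_closed : submod_closed closed_span_pred.
Proof.
split.
  rewrite inE; apply: subset_closure; exists [::]; first by [].
  by rewrite big_nil.
move=> a u v; rewrite !inE => Au Av.
have cf : continuous (fun p : V * V => a *: p.1 + p.2).
  by move=> p; apply: cvgD; [apply: cvgZr; exact: cvg_fst|exact: cvg_snd].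
move=> B /(cf (u, v))[[C D]/= [Cu Dv] CDB].
have [c [[s sA ->{c}] Cc]] := Au _ Cu; have [d [[t tA ->{d}] Dd]] := Av _ Dv.
eexists; split; last by apply: (CDB (_, _)); split; [exact: Cc|exact: Dd].
exists ([seq (a * p.1, p.2) | p <- s] ++ t) => [p|/=].
  by rewrite mem_cat => /orP[/mapP[q /sA ? ->]|/tA].
rewrite big_cat big_map scaler_sumr; congr (_ + _).
by apply: eq_bigr => p _; rewrite scalerA.
Qed.

HB.instance Definition _ := GRing.isSubmodClosed.Build _ _ closed_span_pred
  closed_span_submod_closed.
HB.instance Definition _ := [SubChoice_isSubLmodule of closed_span by <:].

Let cnorm (u : closed_span) : R := `|cspan_val u|.

Let ler_cnormD u v : cnorm (u + v) <= cnorm u + cnorm v.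
Proof. exact: ler_normD. Qed.

Let cnormZ (a : R) u : cnorm (a *: u) = `|a| * cnorm u.
Proof. exact: normrZ. Qed.

Let cnorm_eq0 u : cnorm u = 0 -> u = 0.
Proof. by move=> /normr0_eq0 u0; exact/val_inj. Qed.

HB.instance Definition _ :=
  Lmodule_isNormed.Build R closed_span ler_cnormD cnormZ cnorm_eq0.

Lemma cspan_normE (u : closed_span) : `|u| = `|cspan_val u|. Proof. by []. Qed.

End closed_span.

Section closed_span_complete.
Context {R : realType} {V : completeNormedModType R} (A : set V).

Lemma closed_span_complete (F : set_system (closed_span A)) :
  ProperFilter F -> cauchy F -> cvg F.
Proof.
move=> FF /cauchy_ballP Fc.
have : cvg (@cspan_val _ _ A @ F).
  apply/cauchy_cvgP/cauchy_ballP => e e0.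
  have [[C D]/= [FC FD] CD] := Fc _ e0.
  exists (@cspan_val _ _ A @` C, @cspan_val _ _ A @` D).
    by split; [apply: filterS FC|apply: filterS FD] => f ?; exists f.
  move=> [_ _]/= [[f Cf <-] [h Dh <-]]; rewrite -ball_normE/=.
  by have := CD (f, h) (conj Cf Dh); rewrite -ball_normE.
move=> /cvg_ex[l Fl].
have lP : l \in closed_span_pred A.
  rewrite inE; apply: (closed_cvg (closure (lspan A))) Fl.
    exact: closed_closure.
  by apply: nearW => u; have := cspan_valP u; rewrite inE.
apply/cvg_ex; exists (ClosedSpan lP); apply/cvgrPdist_le => e e0.
by move/cvgrPdist_le : Fl => /(_ e e0).
Qed.

HB.instance Definition _ :=
  Uniform_isComplete.Build (closed_span A) closed_span_complete.

End closed_span_complete.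

(* The point o is the origin 0 of the pointed metric space M. *)
Section lip0.
Context {R : realType} {M : metricType R} (o : M).

Definition lip0_pred : {pred M -> R} :=
  mem [set f : M -> R | f o = 0 /\
    exists k : R, forall x y, `|f x - f y| <= k * mdist x y].

Record lip0 := Lip0 { lip0_fun :> M -> R; lip0_funP : lip0_fun \in lip0_pred }.

HB.instance Definition _ := [isSub for lip0_fun].
HB.instance Definition _ := [Choice of lip0 by <:].

(* A pair p with p.1 = p.2 contributes the slope 0 / 0 = 0, so that the set is
   never empty. *)
Definition lip_const (f : M -> R) : R :=
  sup [set `|f p.1 - f p.2| / mdist p.1 p.2 | p in [set: M * M]].

Lemma lip0_o (f : lip0) : f o = 0.
Proof. by have := lip0_funP f; rewrite inE => -[]. Qed.

Lemma lip_const_le (f : M -> R) (k : R) : 0 <= k ->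
  (forall x y, `|f x - f y| <= k * mdist x y) -> lip_const f <= k.
Proof.
move=> k0 fk; apply: ge_sup; first by eexists; exists (o, o).
move=> _ [[x y] _ <-]/=; have [->|xy] := eqVneq x y.
  by rewrite subrr normr0 mul0r.
by rewrite ler_pdivrMr// mdist_gt0.
Qed.

Lemma lip0_has_sup (f : lip0) :
  has_sup [set `|f p.1 - f p.2| / mdist p.1 p.2 | p in [set: M * M]].
Proof.
have := lip0_funP f; rewrite inE => -[_ [k fk]].
split; first by eexists; exists (o, o).
exists `|k| => _ [[x y] _ <-]/=; have [->|xy] := eqVneq x y.
  by rewrite subrr normr0 mul0r.
rewrite ler_pdivrMr ?mdist_gt0// (le_trans (fk x y))//.
by rewrite ler_wpM2r ?mdist_ge0// ler_norm.
Qed.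

Lemma lip_const_ge0 (f : lip0) : 0 <= lip_const f.
Proof.
have /sup_upper_bound := lip0_has_sup f; apply.
by exists (o, o) => //=; rewrite subrr normr0 mul0r.
Qed.

Lemma lip_constP (f : lip0) x y : `|f x - f y| <= lip_const f * mdist x y.
Proof.
have [->|xy] := eqVneq x y.
  by rewrite subrr normr0 mdistxx mulr0.
rewrite -ler_pdivrMr ?mdist_gt0//.
by have /sup_upper_bound := lip0_has_sup f; apply; exists (x, y).
Qed.

Lemma lip0_submod_closed : submod_closed lip0_pred.
Proof.
split.
  rewrite inE/=; split => //; exists 0 => x y.
  by rewrite /= subrr normr0 mul0r.
move=> a f g; rewrite !inE/= => -[fo [k fk]] [go [l gl]]; split.
  by rewrite !fctE fo go /GRing.scale/= mulr0 addr0.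
exists (`|a| * k + l) => x y; rewrite !fctE.
rewrite opprD addrACA -scalerBr (le_trans (ler_normD _ _))// mulrDl.
by rewrite lerD// normrZ -mulrA ler_wpM2l.
Qed.

HB.instance Definition _ := GRing.isSubmodClosed.Build _ _ lip0_pred
  lip0_submod_closed.
HB.instance Definition _ := [SubChoice_isSubLmodule of lip0 by <:].

Let lnorm (f : lip0) : R := lip_const f.

Let ler_lnormD f g : lnorm (f + g) <= lnorm f + lnorm g.
Proof.
apply: lip_const_le => [|x y]; first by rewrite addr_ge0 ?lip_const_ge0.
rewrite [X in `|X|](_ : _ = (f x - f y) + (g x - g y)); last first.
  by rewrite addrACA -opprD.
by rewrite (le_trans (ler_normD _ _))// mulrDl lerD ?lip_constP.
Qed.

Let lnormZ (a : R) f : lnorm (a *: f) = `|a| * lnorm f.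
Proof.
have le b g : lnorm (b *: g) <= `|b| * lnorm g.
  apply: lip_const_le => [|x y]; first by rewrite mulr_ge0 ?lip_const_ge0.
  rewrite [X in `|X|](_ : _ = b * (g x - g y)); last by rewrite mulrBr.
  by rewrite normrM -mulrA ler_wpM2l ?lip_constP.
apply/eqP; rewrite eq_le le/=.
have [->|a0] := eqVneq a 0.
  by rewrite normr0 mul0r lip_const_ge0.
rewrite -ler_pdivlMl ?normr_gt0// -normfV.
by have := le a^-1 (a *: f); rewrite scalerA mulVf// scale1r.
Qed.

Let lnorm_eq0 f : lnorm f = 0 -> f = 0.
Proof.
move=> f0; apply/val_inj/funext => x; apply/eqP.
rewrite -normr_le0; have := lip_constP f x o.
by rewrite lip0_o subr0 -/(lnorm f) f0 mul0r.
Qed.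

HB.instance Definition _ :=
  Lmodule_isNormed.Build R lip0 ler_lnormD lnormZ lnorm_eq0.

Lemma lip0_normE (f : lip0) : `|f| = lip_const f. Proof. by []. Qed.

Lemma evaluation_dual (x : M) : (fun f : lip0 => f x) \in @dual_pred R lip0.
Proof.
rewrite inE; split; first by [].
by exists (mdist x o) => f; have := lip_constP f x o; rewrite lip0_o subr0 mulrC.
Qed.

Definition delta (x : M) : dual lip0 := Dual (evaluation_dual x).

Definition lipschitz_free := closed_span (range delta).

HB.instance Definition _ := CompleteNormedModule.on lipschitz_free.

End lip0.

(* Main.v *)
From HB Require Import structures.
Require Import Defs.
From mathcomp Require Import all_boot all_order all_algebra.
From mathcomp Require Import all_classical reals topology normedtype.
From mathcomp Require Import sequences exp ring lra.
Import Order.TTheory GRing.Theory Num.Theory.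
Import numFieldNormedType.Exports.
Local Open Scope classical_set_scope.
Local Open Scope ring_scope.
Set Implicit Arguments.
Unset Strict Implicit.
Unset Printing Implicit Defensive.

(** The space F(M) has the metric approximation property as soon as, for every
    L > 1 and every finite E in M, some finite-rank operator of norm at most L
    fixes the evaluations at the points of E: such operators converge to the
    identity on compact sets, and dividing them by L brings the norm down to 1
    ([metric_approximation_criterion]).  By the universal property of F(M), such
    an operator is the same thing as an L-Lipschitz map phi from M to F(M) that
    vanishes at the origin, takes its values in the span of finitely many
    evaluations and satisfies phi x = delta x on E ([lipschitz_extension]).

    These maps are built by gluing.  If psi is L'-Lipschitz on p and the support
    of a function lam : M -> [0, 1], and psi p = delta p, then
      phi x = lam x * psi x + (1 - lam x) * delta p
    is Lipschitz on all of M, with a constant that exceeds L' by an arbitrarily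
    small factor if lam varies slowly on the logarithmic scale of the
    distance to p ([almost_identity_glue]).  So a small ball around p can be
    collapsed to p, and the complement of a large ball around the origin can be
    collapsed to the origin, at almost no cost ([cutoff_near], [cutoff_far]).

    First collapse the outside of a large ball, which leaves a compact set since
    M is proper.  Then enumerate M as x_0, x_1, ... and fix beforehand a radius
    s_n for each x_n, small enough that the collapse around x_n leaves E and the
    other x_i with i < n where they are, and costs so little that all these
    collapses together keep the constant below L.  By compactness finitely many
    of the balls B(x_n, s_n) cover the compact set.  After the corresponding
    collapses only finitely many points are left, and there delta itself does
    the job. *)

(** * Logarithmic cutoff functions *)

Section cutoffs.
Context {R : realType} {M : metricType R}.
Implicit Types (p x y : M) (E : seq M).

(** A form of eps-Lipschitz continuity of lam in log (mdist x p).  The factor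
    is the smaller of the two distances to p, as this is what the inequality
    t * (ln u - ln t) <= u - t, for 0 < t <= u, provides. *)
Definition cutoff (eps : R) p (lam : M -> R) :=
  (forall x, 0 <= lam x <= 1) /\
  forall x y, mdist y p <= mdist x p ->
    `|lam x - lam y| * mdist y p <= eps * mdist x y.

Let clamp (u : R) : R := Num.max 0 (Num.min 1 u).

Let clamp_itv u : 0 <= clamp u <= 1.
Proof.
rewrite /clamp /Num.max /Num.min.
by case: (ltP 1 u) => ?; case: ltP => ?; lra.
Qed.

Let clamp_lip u v : `|clamp u - clamp v| <= `|u - v|.
Proof.
rewrite ler_norml /clamp /Num.max /Num.min.
case: (ger0P (u - v)) => ?; case: (ltP 1 u) => ?; case: (ltP 1 v) => ?;
  do ?[case: ltP => ?]; lra.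
Qed.

Let ln_lip (t u : R) : 0 < t -> t <= u -> `|ln u - ln t| * t <= u - t.
Proof.
move=> t0 tu; have u0 : 0 < u by exact: lt_le_trans tu.
rewrite ger0_norm ?subr_ge0 ?ler_ln//.
rewrite -ler_pdivlMr// -ln_div// mulrBl divff ?gt_eqF//.
have := @le_ln1Dx R (u / t - 1); rewrite [1 + _]addrC subrK; apply.
by rewrite ltrBrDl subrr divr_gt0.
Qed.

Let log_cutoff (eps a e b : R) p : `|e| = eps -> 0 <= b <= 1 ->
  cutoff eps p (fun x => if x == p then b else clamp (a + e * ln (mdist x p))).
Proof.
move=> eE b01; have eps0 : 0 <= eps by rewrite -eE.
split => [x|x y yx]; first by case: ifP.
have [->|yp] := eqVneq y p; first by rewrite mdistxx mulr0 mulr_ge0// mdist_ge0.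
have y0 : 0 < mdist y p by rewrite mdist_gt0.
have x0 := lt_le_trans y0 yx.
rewrite /= ifN; last by rewrite -mdist_gt0.
apply: le_trans (_ : `|e * (ln (mdist x p) - ln (mdist y p))| * mdist y p <= _).
  rewrite ler_wpM2r ?(ltW y0)//; apply: le_trans (clamp_lip _ _) _.
  by rewrite le_eqVlt; apply/orP; left; apply/eqP; congr (`|_|); ring.
rewrite normrM eE -mulrA ler_wpM2l//; apply: le_trans (ln_lip y0 yx) _.
by rewrite lerBlDr metric_triangle.
Qed.

Lemma separation_radius p E :
  exists2 r : R, 0 < r & forall x, x \in E -> x != p -> r <= mdist x p.
Proof.
elim: E => [|y E [r r0 rE]]; first by exists 1.
have [yp|yp] := eqVneq y p.
  by exists r => // x; rewrite inE => /orP[/eqP->|/rE//]; rewrite yp eqxx.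
exists (Num.min r (mdist y p)); first by rewrite lt_min r0 mdist_gt0.
move=> x; rewrite inE ge_min => /orP[/eqP -> _|xE xp]; last by rewrite rE.
by rewrite lexx orbT.
Qed.

(** The function 1 + eps * ln (d / r), truncated to [0, 1], where r bounds below
    the distances d from p to the other points of E.  It reaches 0 at
    d = r * exp (- 1 / eps). *)
Lemma cutoff_near (eps : R) p E : 0 < eps -> exists lam s,
  [/\ cutoff eps p lam, 0 < s, forall x, mdist x p < s -> lam x = 0 &
      forall x, x \in E -> x != p -> lam x = 1].
Proof.
move=> eps0; have [r r0 rE] := separation_radius p E.
pose lam x := if x == p then 0 else
  clamp (1 - eps * ln r + eps * ln (mdist x p)).
exists lam, (r * expR (- eps^-1)); split.
- by apply: log_cutoff; rewrite ?lexx ?ler01// gtr0_norm.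
- by rewrite mulr_gt0 ?expR_gt0.
- move=> x xs; rewrite /lam; case: eqVneq => // xp.
  apply/max_idPl; rewrite ge_min; apply/orP; right.
  have x0 : 0 < mdist x p by rewrite mdist_gt0.
  have : ln (mdist x p) <= ln (r * expR (- eps^-1)).
    by rewrite ler_ln ?posrE ?mulr_gt0 ?expR_gt0// ltW.
  rewrite lnM ?posrE ?expR_gt0// expRK -(ler_pM2l eps0) mulrDr mulrN.
  by rewrite divff ?gt_eqF//; lra.
- move=> x /rE rx xp; rewrite /lam (negbTE xp) /clamp.
  rewrite min_l ?max_r// -addrA lerDl addrC -mulrBr pmulr_rge0//.
  by rewrite subr_ge0 ler_ln ?posrE ?mdist_gt0// rx.
Qed.

(** The function 1 - eps * ln (d / r), truncated to [0, 1], where r bounds the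
    distances from p to the points of E. *)
Lemma cutoff_far (eps : R) p E : 0 < eps -> exists lam r,
  [/\ cutoff eps p lam, forall x, r < mdist x p -> lam x = 0 &
      forall x, x \in E -> x != p -> lam x = 1].
Proof.
move=> eps0.
have [r r0 rE] : exists2 r : R, 0 < r & forall x, x \in E -> mdist x p <= r.
  elim: E => [|y E [r r0 rE]]; first by exists 1.
  exists (Num.max r (mdist y p)); first by rewrite lt_max r0.
  move=> x; rewrite inE le_max => /orP[/eqP->|/rE ->//].
  by rewrite lexx orbT.
pose lam x := if x == p then 1 else
  clamp (1 + eps * ln r + (- eps) * ln (mdist x p)).
exists lam, (r * expR eps^-1); split.
- by apply: log_cutoff; rewrite ?lexx ?ler01// normrN gtr0_norm.
- move=> x xs; rewrite /lam.
  have s0 : 0 < r * expR eps^-1 by rewrite mulr_gt0 ?expR_gt0.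
  have x0 := lt_trans s0 xs.
  case: eqVneq => [xp|_]; first by rewrite xp mdistxx ltxx in x0.
  apply/max_idPl; rewrite ge_min; apply/orP; right.
  have : ln (r * expR eps^-1) <= ln (mdist x p) by rewrite ler_ln ?posrE// ltW.
  rewrite lnM ?posrE ?expR_gt0// expRK -(ler_pM2l eps0) mulrDr.
  by rewrite divff ?gt_eqF//; lra.
- move=> x /rE rx xp; rewrite /lam (negbTE xp) /clamp.
  rewrite min_l ?max_r// -addrA lerDl mulNr -mulrBr pmulr_rge0//.
  by rewrite subr_ge0 ler_ln ?posrE ?mdist_gt0.
Qed.

End cutoffs.

(** * Linear spans *)

Section linear_spans.
Context {R : realType} {V : normedModType R}.
Implicit Types A B : set V.

Lemma lspan_sub A : A `<=` lspan A.
Proof.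
move=> v Av; exists [:: (1, v)]; first by move=> p; rewrite inE => /eqP ->.
by rewrite big_seq1 scale1r.
Qed.

Lemma lspan_lincomb A (a : R) u v :
  lspan A u -> lspan A v -> lspan A (a *: u + v).
Proof.
move=> [s sA ->] [t tA ->]; exists ([seq (a * p.1, p.2) | p <- s] ++ t).
  by move=> p; rewrite mem_cat => /orP[/mapP[q /sA ? ->]|/tA].
rewrite big_cat big_map scaler_sumr; congr (_ + _).
by apply: eq_bigr => p _; rewrite scalerA.
Qed.

Lemma lspan_min A B : B 0 -> (forall a u v, B u -> B v -> B (a *: u + v)) ->
  A `<=` B -> lspan A `<=` B.
Proof.
move=> B0 BD AB _ [s sA ->]; elim: s sA => [|p s IH] sA; first by rewrite big_nil.
rewrite big_cons; apply: BD; first by apply/AB/sA; rewrite mem_head.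
by apply: IH => q qs; apply: sA; rewrite inE qs orbT.
Qed.

Lemma lspan0 A : lspan A 0.
Proof. by exists [::] => //; rewrite big_nil. Qed.

Lemma lspanS A B : A `<=` B -> lspan A `<=` lspan B.
Proof.
move=> AB; apply: lspan_min; [exact: lspan0|exact: lspan_lincomb|].
by move=> v /AB; exact: lspan_sub.
Qed.

(** Induction on the number of generators: writing the elements of W as
    a *: v + u with u in the span of the other generators, those with a = 0 are
    finitely generated, and they generate W together with any single element
    for which a is not 0. *)
Lemma subspace_finitely_generated (s : seq V) (W : set V) :
  W 0 -> (forall a u v, W u -> W v -> W (a *: u + v)) ->
  W `<=` lspan [set` s] -> exists t : seq V, W = lspan [set` t].
Proof.
elim: s W => [|v s IH] W W0 WD Ws.
  exists [::]; apply/seteqP; split; first exact: Ws.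
  by apply: lspan_min.
have Wsplit : W `<=` [set w | exists a u, lspan [set` s] u /\ w = a *: v + u].
  apply: subset_trans Ws _; apply: lspan_min => [||x /=].
  - by exists 0, 0; split; [exact: lspan0|rewrite scale0r addr0].
  - move=> c _ _ [a [u [su ->]]] [a' [u' [su' ->]]].
    exists (c * a + a'), (c *: u + u'); split; first exact: lspan_lincomb.
    by rewrite scalerDr scalerDl scalerA addrACA.
  - rewrite inE => /orP[/eqP ->|xs].
      by exists 1, 0; split; [exact: lspan0|rewrite scale1r addr0].
    exists 0, x; split; first exact: lspan_sub.
    by rewrite scale0r add0r.
have [t tE] : exists t : seq V, W `&` lspan [set` s] = lspan [set` t].
  apply: IH => //; first by split => //; exact: lspan0.
  by move=> a u w [? ?] [? ?]; split; [exact: WD|exact: lspan_lincomb].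
have tW : lspan [set` t] `<=` W by rewrite -tE.
have [Wsub|/existsNP[w /not_implyP[Ww sw]]] :=
  pselect (forall w, W w -> lspan [set` s] w).
  by exists t; rewrite -tE; apply/seteqP; split => // w Ww; split => //; exact: Wsub.
have [a [u [su wE]]] := Wsplit _ Ww.
have a0 : a != 0.
  by apply: contra_notN sw => /eqP a0; rewrite wE a0 scale0r add0r.
exists (w :: t); apply/seteqP; split.
- move=> x Wx; have [b [z [sz xE]]] := Wsplit _ Wx.
  have tx : lspan [set` t] (- (b / a) *: w + x).
    rewrite -tE; split; first exact: WD.
    rewrite [X in lspan _ X](_ : _ = - (b / a) *: u + z); first exact: lspan_lincomb.
    rewrite wE xE scalerDr addrACA scalerA mulNr divfK// scaleNr addNr add0r.
    by rewrite scaleNr.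
  have -> : x = (b / a) *: w + (- (b / a) *: w + x).
    by rewrite addrA -scalerDl subrr scale0r add0r.
  apply: lspan_lincomb; first by apply: lspan_sub; rewrite /= mem_head.
  by apply: lspanS tx => y /= ty; rewrite inE ty orbT.
- apply: lspan_min => // y /=; rewrite inE => /orP[/eqP -> //|yt].
  by apply: tW; exact: lspan_sub.
Qed.

End linear_spans.

(** * Almost identical maps into the free space, and how to glue them *)

Section gluing.
Context {R : realType} {M : metricType R} (o : M).
Implicit Types (p x y : M) (E : seq M) (N : set M) (L eps : R).

Lemma delta_lip x y : `|delta o x - delta o y| <= mdist x y.
Proof.
apply: opnorm_le => [|f]; first exact: mdist_ge0.
by rewrite mulrC; exact: lip_constP.
Qed.

(** The first and last clauses are relative to N because gluing shrinks the
    domain; the equality on E is not, which spares an inclusion of E in N. *)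
Definition almost_identity L E N := exists (phi : M -> dual (lip0 o)) (s : seq M),
  [/\ forall x y, N x -> N y -> `|phi x - phi y| <= L * mdist x y,
      forall x, x \in E -> phi x = delta o x &
      forall x, N x -> lspan [set delta o z | z in [set` s]] (phi x)].

Lemma almost_identity_finite L E N (s : seq M) :
  1 <= L -> N `<=` [set` s] -> almost_identity L E N.
Proof.
move=> L1 Ns; exists (delta o), s; split => // [x y _ _|x /Ns xs].
  by rewrite (le_trans (delta_lip _ _))// ler_peMl// mdist_ge0.
by apply: lspan_sub; exists x.
Qed.

(** With d p := mdist _ p, if d p y <= d p x then
      phi x - phi y = lam x *: (psi x - psi y) + (lam x - lam y) *: (psi y - delta p)
    has norm at most L' * mdist x y + L' * (L / L' - 1) * mdist x y.  The points
    where lam vanishes need a separate treatment, as psi is not controlled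
    there; if lam y = 0 then d p x <= mdist x y + d p y takes care of it. *)
Lemma almost_identity_glue L' L p lam E N : 0 < L' -> L' < L ->
  cutoff (L / L' - 1) p lam -> (forall x, x \in E -> x != p -> lam x = 1) ->
  almost_identity L' (p :: E) (p |` (N `&` [set x | lam x != 0])) ->
  almost_identity L E N.
Proof.
move=> L'0 L'L [lam01 lam_slow] lamE [psi [s [psi_lip psiE psi_span]]].
have psip : psi p = delta o p by apply: psiE; rewrite mem_head.
pose phi x := lam x *: (psi x - delta o p) + delta o p.
have lamge x : 0 <= lam x by have /andP[] := lam01 x.
have lamle x : lam x <= 1 by have /andP[] := lam01 x.
have psi_p x : N x -> lam x != 0 -> `|psi x - delta o p| <= L' * mdist x p.
  by move=> Nx lx; rewrite -psip; apply: psi_lip; [right|left].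
have phi_lip x y : N x -> N y -> mdist y p <= mdist x p ->
    `|phi x - phi y| <= L * mdist x y.
  move=> Nx Ny yx.
  have L'eps : L' * (mdist x y + (L / L' - 1) * mdist x y) = L * mdist x y.
    by field; rewrite gt_eqF.
  have -> : phi x - phi y =
      lam x *: (psi x - delta o p) - lam y *: (psi y - delta o p).
    by rewrite /phi opprD addrACA subrr addr0.
  (* Outside the support of lam the map is constant, equal to delta p. *)
  have [ly|ly] := eqVneq (lam y) 0.
    have [lx|lx] := eqVneq (lam x) 0.
      rewrite lx ly !scale0r subrr normr0 mulr_ge0 ?mdist_ge0//.
      by rewrite ltW// (lt_trans L'0).
    rewrite ly scale0r subr0 normrZ ger0_norm//.
    apply: le_trans (_ : lam x * (L' * (mdist x y + mdist y p)) <= _).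
      rewrite ler_wpM2l//; apply: le_trans (psi_p _ Nx lx) _.
      by rewrite ler_pM2l// metric_triangle.
    have := lam_slow _ _ yx; rewrite ly subr0 ger0_norm// => slow.
    rewrite mulrCA -L'eps ler_pM2l// mulrDr lerD//.
    by rewrite ler_piMl ?mdist_ge0.
  have [lx|lx] := eqVneq (lam x) 0.
    rewrite lx scale0r sub0r normrN normrZ.
    have := lam_slow _ _ yx; rewrite lx sub0r normrN => slow.
    apply: le_trans (_ : `|lam y| * (L' * mdist y p) <= _).
      by rewrite ler_wpM2l// psi_p.
    rewrite mulrCA -L'eps ler_pM2l//; apply: le_trans slow _.
    by rewrite lerDr mdist_ge0.
  have -> : lam x *: (psi x - delta o p) - lam y *: (psi y - delta o p) =
      lam x *: (psi x - psi y) + (lam x - lam y) *: (psi y - delta o p).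
    rewrite scalerBl addrA; congr (_ - _); rewrite -scalerDr; congr (_ *: _).
    by rewrite addrA subrK.
  apply: le_trans (ler_normD _ _) _; rewrite -L'eps mulrDr !normrZ; apply: lerD.
    rewrite ger0_norm//; apply: le_trans (_ : 1 * (L' * mdist x y) <= _).
      by apply: ler_pM => //; apply: psi_lip; right.
    by rewrite mul1r.
  apply: le_trans (_ : `|lam x - lam y| * (L' * mdist y p) <= _).
    by rewrite ler_wpM2l// psi_p.
  by rewrite mulrCA ler_pM2l// lam_slow.
exists phi, (p :: s); split.
- move=> x y Nx Ny.
  have [yx|/ltW xy] := leP (mdist y p) (mdist x p); first exact: phi_lip.
  by rewrite distrC (metric_sym x); exact: phi_lip.
- move=> x xE; rewrite /phi; have [->|xp] := eqVneq x p.
    by rewrite psip subrr scaler0 add0r.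
  by rewrite lamE// scale1r subrK psiE// inE xE orbT.
- move=> x Nx; rewrite /phi.
  have sp : lspan [set delta o z | z in [set` p :: s]] (delta o p).
    by apply: lspan_sub; exists p => //=; rewrite mem_head.
  have [->|lx] := eqVneq (lam x) 0; first by rewrite scale0r add0r.
  apply: lspan_lincomb => //; rewrite -scaleN1r addrC; apply: lspan_lincomb => //.
  have Nx' : (p |` (N `&` [set x | lam x != 0])) x by right.
  apply: lspanS (psi_span _ Nx') => _ [z /= zs <-]; exists z => //=.
  by rewrite inE zs orbT.
Qed.

End gluing.

(** * Collapsing a countable proper space to a finite set *)

Lemma countable_enumeration (T : Type) (o : T) : countable [set: T] ->
  exists x : nat -> T, forall y, exists n, x n = y.
Proof.
move=> /countable_injP[f finj].
have /choice[x xP] : forall n, exists y, forall z, f z = n -> z = y.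
  move=> n; have [[y fy]|nf] := pselect (exists y, f y = n); last first.
    by exists o => z fz; case: nf; exists z.
  by exists y => z fz; apply: finj; rewrite ?in_setT// fy.
by exists x => y; exists (f y); apply/esym/xP.
Qed.

Section almost_identities.
Context {R : realType} {M : metricType R} (o : M).

(** The step n collapses a ball around x n.  It weakens the Lipschitz constant
    from [L_ n.+1] to [L_ n], where [L_ 0 = L] and all the [L_ n] are above 1;
    the cutoff around x n is chosen in terms of n alone, hence before
    compactness tells how many steps are needed. *)
Lemma almost_identity_compact (L : R) (E : seq M) (N K : set M) :
  countable [set: M] -> 1 < L -> compact K -> N `<=` K -> almost_identity o L E N.
Proof.
move=> /(countable_enumeration o)[x xsurj] L1 Kcompact NK.
pose L_ n : R := 1 + (L - 1) / n.+1%:R.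
have L_gt1 n : 1 < L_ n by rewrite ltrDl divr_gt0// subr_gt0.
have L_gt0 n : 0 < L_ n by apply: lt_trans (L_gt1 n).
have L_decr n : L_ n.+1 < L_ n.
  by rewrite ltrD2l ltr_pM2l ?subr_gt0// ltf_pV2 ?posrE// ltr_nat.
(* The points that the map of stage n has to fix. *)
pose E_ := fix E_ n := if n is n'.+1 then x n' :: E_ n' else E.
have /choice[c cP] : forall n, exists c : (M -> R) * R,
    [/\ cutoff (L_ n / L_ n.+1 - 1) (x n) c.1, 0 < c.2,
        forall y, mdist y (x n) < c.2 -> c.1 y = 0 &
        forall y, y \in E_ n -> y != x n -> c.1 y = 1].
  move=> n; have eps0 : 0 < L_ n / L_ n.+1 - 1.
    by rewrite subr_gt0 ltr_pdivlMr// mul1r.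
  by have [lam [s lamP]] := cutoff_near (x n) (E_ n) eps0; exists (lam, s).
(* What is left of N after the first n collapses. *)
pose N_ := fix N_ n := if n is n'.+1
  then x n' |` (N_ n' `&` [set y | (c n').1 y != 0]) else N.
have reduce n : almost_identity o (L_ n) (E_ n) (N_ n) -> almost_identity o L E N.
  elim: n => [|n IH]; first by rewrite /L_ divr1 addrC subrK.
  move=> AI; apply: IH; have [cut _ _ cE] := cP n.
  exact: almost_identity_glue AI.
have N_sub n y : N_ n y -> (exists2 i, (i < n)%N & y = x i) \/
    (N y /\ forall i, (i < n)%N -> (c i).1 y != 0).
  elim: n => [|n IH] /= ; first by right.
  move=> [->|[/IH[[i ni ->]|[Ny cy]] /= cny]]; first by left; exists n.
    by left; exists i => //; rewrite ltnS ltnW.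
  right; split => // i; rewrite ltnS leq_eqVlt => /orP[/eqP -> //|]; exact: cy.
have /filter_ex[n Kn] : \forall n \near \oo,
    K `<=` [set y | exists2 i, (i < n)%N & mdist y (x i) < (c i).2].
  have /compact_near_coveringP := Kcompact; apply => y _.
  have [i xi] := xsurj y; have [_ ci _ _] := cP i.
  exists (ball y (c i).2, [set n | (i < n)%N]).
    by split; [exact: nbhsx_ballx|exact: nbhs_infty_gt].
  move=> [z n] /= [yz ni]; exists i => //.
  by rewrite ballEmdist /= in yz; rewrite xi metric_sym.
apply: (reduce n).
apply: (@almost_identity_finite _ _ _ _ _ _ [seq x i | i <- iota 0 n]).
  exact: ltW.
move=> y /N_sub[[i ni ->]|[/NK/Kn[i ni iy] cy]].
  by apply: map_f; rewrite mem_iota.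
by have [_ _ c0 _] := cP i; have := cy _ ni; rewrite c0 ?eqxx.
Qed.

Lemma almost_identity_proper (L : R) (E : seq M) :
  countable [set: M] -> proper_metric M -> 1 < L ->
  almost_identity o L E setT.
Proof.
move=> Mcountable Mproper L1; pose L' := (1 + L) / 2.
have L'1 : 1 < L' by rewrite /L'; lra.
have L'0 : 0 < L' by apply: lt_trans L'1.
have L'L : L' < L by rewrite /L'; lra.
have eps0 : 0 < L / L' - 1 by rewrite subr_gt0 ltr_pdivlMr// mul1r.
(* The collapse of the complement of a large ball to the origin. *)
have [lam [r [cut lam0 lamE]]] := cutoff_far o E eps0.
apply: almost_identity_glue cut lamE _ => //.
apply: almost_identity_compact (Mproper o `|r|) _ => // y [->|[_ /= ly]] /=.
  by rewrite mdistxx.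
rewrite metric_sym leNgt; apply/negP => ry; move: ly; rewrite lam0 ?eqxx//.
by rewrite (le_lt_trans (ler_norm _)).
Qed.

End almost_identities.

(** * From Lipschitz maps to operators *)

Section operators.
Context {R : realType} {M : metricType R} (o : M).
Implicit Types (x y z : M) (s t : seq M).

Let X : completeNormedModType R := lipschitz_free o.

Lemma dual_sumE (V : normedModType R) I (r : seq I) (g : I -> dual V) (v : V) :
  (\sum_(i <- r) g i) v = \sum_(i <- r) g i v.
Proof. by elim: r => [|i r IH]; rewrite ?big_nil // !big_cons -IH. Qed.

Lemma lip0_sumE I (r : seq I) (g : I -> lip0 o) x :
  (\sum_(i <- r) g i) x = \sum_(i <- r) g i x.
Proof. by elim: r => [|i r IH]; rewrite ?big_nil // !big_cons -IH. Qed.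

Lemma cspan_val_sum (V : normedModType R) (A : set V) I (r : seq I)
    (g : I -> closed_span A) :
  cspan_val (\sum_(i <- r) g i) = \sum_(i <- r) cspan_val (g i).
Proof. by elim: r => [|i r IH]; rewrite ?big_nil // !big_cons -IH. Qed.

Lemma delta_origin : delta o o = 0.
Proof. by apply/val_inj/funext => f; exact: lip0_o. Qed.

(** No function of Lip_0(M) is 1 at the origin, hence the guard on y; it stands
    inside the existential so that one choice yields h for all y in M. *)
Lemma bump_function s y :
  exists h : lip0 o, y != o -> h y = 1 /\ forall z, z \in s -> z != y -> h z = 0.
Proof.
have [yo|yo] := eqVneq y o; first by exists 0.
have [r r0 rP] := separation_radius y (o :: s).
pose f z := Num.max 0 (1 - mdist z y / r).
have f0 z : r <= mdist z y -> f z = 0.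
  by move=> rz; apply/max_idPl; rewrite subr_le0 ler_pdivlMr// mul1r.
have fP : f \in lip0_pred o.
  rewrite inE; split; first by apply: f0; rewrite rP ?mem_head// eq_sym.
  exists r^-1 => a b; rewrite mulrC.
  have : `|mdist a y / r - mdist b y / r| <= mdist a b / r.
    rewrite -mulrBl normrM (gtr0_norm (_ : 0 < r^-1)) ?invr_gt0//.
    rewrite ler_pM2r ?invr_gt0// ler_norml lerBlDr metric_triangle andbT.
    by rewrite lerBrDr addrC lerBlDr [leRHS]addrC (metric_sym a b) metric_triangle.
  rewrite /f /Num.max ler_norml.
  by case: ltP => ?; case: ltP => ?; rewrite ler_norml; lra.
exists (Lip0 fP) => _; split => [|z zs zy] /=.
  by rewrite /f mdistxx mul0r subr0; apply/max_idPr.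
by apply: f0; rewrite rP// inE zs orbT.
Qed.

(** Bump functions are dual to the evaluations at distinct points other than the
    origin, so they give the coordinates on a span of evaluations. *)
Lemma delta_coordinates s : exists t (h : M -> lip0 o), forall v,
  lspan [set delta o z | z in [set` s]] v ->
  v = \sum_(y <- t) v (h y) *: delta o y.
Proof.
have /choice[h hP] := bump_function s.
exists (undup [seq y <- s | y != o]), h; apply: lspan_min.
- by rewrite big1// => y _; rewrite /= scale0r.
- move=> a u v /= uE vE; rewrite {1}uE {1}vE scaler_sumr -big_split /=.
  by apply: eq_bigr => y _; rewrite scalerA -scalerDl.
- move=> _ [z /= zs <-]; have [->|zo] := eqVneq z o.
    by rewrite big1 ?delta_origin// => y _; rewrite /= scale0r.
  have zt : z \in undup [seq y <- s | y != o] by rewrite mem_undup mem_filter zo.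
  rewrite (bigD1_seq z) ?undup_uniq//= (hP z zo).1 scale1r big1_seq ?addr0//.
  move=> y /andP[yz]; rewrite mem_undup mem_filter => /andP[yo ys].
  by rewrite (hP y yo).2 ?scale0r// eq_sym.
Qed.

Definition free_delta x : X := ClosedSpan (mem_set (subset_closure
  (@lspan_sub _ _ (range (delta o)) _ (ex_intro2 _ _ x I erefl)))).

(** If phi x = \sum_y c y x *: delta y then the coefficients c y belong to
    Lip_0(M), and T u := \sum_y u (c y) *: delta y has its values in a space of
    finite dimension.  The bound on T holds because T u (f) = u (g), where
    g = \sum_y f y *: c y is the function x |-> phi x (f), whose Lipschitz
    constant is at most L times that of f. *)
Lemma lipschitz_extension (L : R) (phi : M -> dual (lip0 o)) s : 0 <= L ->
  (forall x y, `|phi x - phi y| <= L * mdist x y) -> phi o = 0 ->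
  (forall x, lspan [set delta o z | z in [set` s]] (phi x)) ->
  exists T : {linear X -> X}, [/\ finite_rank T,
    forall u, `|T u| <= L * `|u| &
    forall x, cspan_val (T (free_delta x)) = phi x].
Proof.
move=> L0 phi_lip phio phi_span; have [t [h hP]] := delta_coordinates s.
have cP y : (fun x => phi x (h y)) \in lip0_pred o.
  rewrite inE; split; first by rewrite phio.
  exists (L * `|h y|) => x z; rewrite mulrAC.
  by apply: le_trans (dual_normP (phi x - phi z) _) _; rewrite ler_wpM2r.
pose c y := Lip0 (cP y).
pose T (u : X) : X := \sum_(y <- t) cspan_val u (c y) *: free_delta y.
have Tlin : linear T.
  move=> a u v; rewrite /T scaler_sumr -big_split /=.
  by apply: eq_bigr => y _; rewrite scalerA -scalerDl.
pose T' : {linear X -> X} := HB.pack T (GRing.isLinear.Build R X X _ T Tlin).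
have TE u : cspan_val (T u) = \sum_(y <- t) cspan_val u (c y) *: delta o y.
  exact: cspan_val_sum.
exists T'; split.
- pose tX := [seq free_delta y | y <- t].
  apply: (@subspace_finitely_generated _ _ tX).
  + by exists 0 => //; exact: (linear0 T').
  + move=> a _ _ [u _ <-] [v _ <-]; exists (a *: u + v) => //.
    exact: (linearP T').
  + move=> _ [u _ <-]; exists [seq (cspan_val u (c y), free_delta y) | y <- t].
      by move=> _ /mapP[y yt ->]; apply: map_f.
    by rewrite big_map.
- move=> u; apply: opnorm_le => [|f]; first by rewrite mulr_ge0.
  have -> : cspan_val (T u) f = cspan_val u (\sum_(y <- t) f y *: c y).
    rewrite TE dual_sumE raddf_sum; apply: eq_bigr => y _.
    transitivity (f y * cspan_val u (c y)); first exact: mulrC.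
    by apply/esym; exact: linearZ.
  apply: le_trans (dual_normP _ _) _; rewrite mulrAC mulrC ler_wpM2r//.
  apply: (lip_const_le o) => [|x z]; first by rewrite mulr_ge0.
  have cE w : (\sum_(y <- t) f y *: c y) w = phi w f.
    rewrite lip0_sumE [in RHS](hP _ (phi_span w)) dual_sumE.
    by apply: eq_bigr => y _; exact: mulrC.
  rewrite !cE mulrAC.
  by apply: le_trans (dual_normP (phi x - phi z) _) _; rewrite ler_wpM2r.
- by move=> x; rewrite TE [RHS](hP _ (phi_span x)).
Qed.

End operators.

(** * Approximation on compact sets *)

Section approximation.
Context {R : realType}.

Lemma compact_net (X : normedModType R) (D K : set X) (e : R) : 0 < e ->
  (forall x, exists2 d, D d & `|x - d| < e) -> compact K ->
  exists2 s : seq X, (forall d, d \in s -> D d) &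
    forall x, K x -> exists2 d, d \in s & `|x - d| < e.
Proof.
move=> e0 Dd; rewrite compact_cover => /(_ X D (fun d => ball d e)).
case=> [d _||s sD sK]; first exact: ball_open.
  move=> x _; have [d Dd' xd] := Dd x; exists d => //=.
  by rewrite -ball_normE /= distrC.
exists (finmap.enum_fset s) => [d ds|x /sK[d /= ds]]; first exact: set_mem (sD d ds).
by rewrite -ball_normE /= distrC => dx; exists d.
Qed.

(** For x in K and d at distance less than eps / 4 from x in a finite set s of
    vectors fixed by T, the operator T / L moves x by at most
      |(T / L)(x - d)| + (1 - 1 / L) |d| + |d - x|,
    and L is chosen so that (L - 1) |d| <= eps / 4 for all d in s. *)
Lemma metric_approximation_criterion (X : completeNormedModType R) (D : set X) :
  (forall (e : R) x, 0 < e -> exists2 d, D d & `|x - d| < e) ->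
  (forall (L : R) (s : seq X), 1 < L -> (forall d, d \in s -> D d) ->
    exists T : {linear X -> X}, [/\ finite_rank T,
      forall u, `|T u| <= L * `|u| & forall d, d \in s -> T d = d]) ->
  metric_approximation_property X.
Proof.
move=> Ddense DT eps K eps0 Kcompact.
have e40 : 0 < eps / 4 by rewrite divr_gt0.
have [s sD sK] := compact_net e40 (fun x => Ddense _ x e40) Kcompact.
have [B [B0 sB]] : exists B : R, 0 < B /\ forall d, d \in s -> `|d| <= B.
  elim: s {sD sK} => [|d s [B [B0 sB]]]; first by exists 1.
  exists (Num.max B `|d|); split; first by rewrite lt_max B0.
  move=> x; rewrite inE le_max => /orP[/eqP ->|/sB -> //].
  by rewrite lexx orbT.
pose L := 1 + eps / (4 * B).
have L1 : 1 < L by rewrite ltrDl divr_gt0// mulr_gt0.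
have L0 : 0 < L by apply: lt_trans L1.
have [T [[t Tt] TL Ts]] := DT L s L1 sD.
have T'le u : `|L^-1 *: T u| <= 1 * `|u|.
  by rewrite normrZ gtr0_norm ?invr_gt0// mul1r ler_pdivrMl.
exists (L^-1 \*: T); split.
- by exists 1.
- exists t; rewrite -Tt; apply/seteqP; split => _ [u _ <-].
    by exists (L^-1 *: u) => //; rewrite linearZ.
  by exists (L *: u) => //=; rewrite linearZ scalerA mulVf ?scale1r// gt_eqF.
- exact: opnorm_le.
- move=> x /sK[d ds xd] /=.
  have -> : L^-1 *: T x - x = L^-1 *: T (x - d) + ((L^-1 - 1) *: d + (d - x)).
    rewrite linearB /= (Ts d ds) scalerBr scalerBl scale1r [in RHS]addrA.
    by rewrite [_ - _ + (_ - _)]addrA subrK addrA subrK.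
  have V0 : 0 <= 1 - L^-1 by rewrite subr_ge0 invf_le1// ltW.
  have dB : `|(L^-1 - 1) *: d| <= eps / 4.
    rewrite normrZ distrC ger0_norm//.
    apply: le_trans (_ : (L - 1) * B <= _); last first.
      by rewrite le_eqVlt; apply/orP; left; apply/eqP; rewrite /L; field; rewrite gt_eqF.
    apply: ler_pM => //; last exact: sB.
    have -> : 1 - L^-1 = (L - 1) / L by rewrite mulrBl divff ?gt_eqF// mul1r.
    by rewrite ler_pdivrMr// ler_peMr ?subr_ge0 ?(ltW L1).
  have Txd := T'le (x - d); have dx : `|d - x| < eps / 4 by rewrite distrC.
  apply: le_lt_trans (ler_normD _ _) _.
  have := ler_normD ((L^-1 - 1) *: d) (d - x); lra.
Qed.

Lemma cspan_dense (V : completeNormedModType R) (A : set V) (e : R)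
    (u : closed_span A) : 0 < e ->
  exists2 w : closed_span A, lspan A (cspan_val w) & `|u - w| < e.
Proof.
move=> e0; have := cspan_valP u; rewrite inE => uA.
have [v [vA uv]] := uA _ (nbhsx_ballx (cspan_val u) _ e0).
exists (ClosedSpan (mem_set (subset_closure vA))) => //.
by rewrite -ball_normE in uv.
Qed.

Lemma lspan_finite_support (V : normedModType R) (I : choiceType) (g : I -> V) v :
  lspan (range g) v -> exists s : seq I, lspan [set g i | i in [set` s]] v.
Proof.
move: v; apply: (@lspan_min _ _ _
  [set v | exists s : seq I, lspan [set g i | i in [set` s]] v]) => /=.
- by exists [::]; exact: lspan0.
- move=> a u v [s us] [t vt]; exists (s ++ t); apply: lspan_lincomb.
    by apply: lspanS us => _ [i /= si <-]; exists i => //=; rewrite mem_cat si.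
  by apply: lspanS vt => _ [i /= ti <-]; exists i => //=; rewrite mem_cat ti orbT.
- move=> _ [i _ <-]; exists [:: i]; apply: lspan_sub; exists i => //=.
  by rewrite mem_head.
Qed.

End approximation.

Theorem theorem2p6 (R : realType) (M : metricType R) (o : M)
    (Mcountable : countable [set: M]) (Mproper : proper_metric M) :
  metric_approximation_property (lipschitz_free o).
Proof.
apply: (@metric_approximation_criterion _ _
  [set w | lspan (range (delta o)) (cspan_val w)]) => [e x|L ws L1 wsD].
  exact: cspan_dense.
have L0 : 0 < L by apply: lt_trans L1.
(* The points that occur in the given finite combinations of evaluations. *)
have [E wsE] : exists E : seq M, forall w, w \in ws ->
    lspan [set delta o x | x in [set` E]] (cspan_val w).
  elim: ws wsD => [|w ws IH] wsD; first by exists [::].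
  have [|E wsE] := IH; first by move=> d ds; apply: wsD; rewrite inE ds orbT.
  have [E' wE'] := lspan_finite_support (wsD w (mem_head _ _)).
  exists (E' ++ E) => d; rewrite inE => /orP[/eqP ->|/wsE dE].
    by apply: lspanS wE' => _ [y /= yE' <-]; exists y => //=; rewrite mem_cat yE'.
  by apply: lspanS dE => _ [y /= yE <-]; exists y => //=; rewrite mem_cat yE orbT.
have [phi [s [phi_lip phiE phi_span]]] :=
  almost_identity_proper o (o :: E) Mcountable Mproper L1.
have phio : phi o = 0 by rewrite phiE ?mem_head// delta_origin.
have [T [Tfin TL TE]] := lipschitz_extension (ltW L0)
  (fun x y => phi_lip x y I I) phio (fun x => phi_span x I).
exists T; split => // w /wsE wE.
suff [u [uw Tu]] : exists u : lipschitz_free o, cspan_val u = cspan_val w /\ T u = u.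
  by have <- : u = w by exact: val_inj.
move: (cspan_val w) wE; apply: (@lspan_min _ _ _ [set v |
    exists u : lipschitz_free o, cspan_val u = v /\ T u = u]) => /=.
- by exists 0; split => //; exact: linear0.
- move=> a _ _ [u [<- Tu]] [v [<- Tv]]; exists (a *: u + v); split => //.
  by rewrite linearP Tu Tv.
- move=> _ [x /= xE <-]; exists (free_delta o x); split => //.
  by apply: val_inj; rewrite [LHS]TE phiE// inE xE orbT.
Qed.
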